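(* Assume that the modal DG initial-value problem $$\frac{d\tilde{\boldsymbol u}}{dt}=\sum_{d=1}^{D}\mathsf V_{x_d}^T\mathsf W\,\boldsymbol f_d(\mathsf V\tilde{\boldsymbol u})-\mathsf V_\Gamma^T\mathsf W_\Gamma\,\boldsymbol f_n^*(\mathsf V_\Gamma\tilde{\boldsymbol u},\boldsymbol g_\Gamma)+\mathsf V^T\mathsf W\,\boldsymbol s(\mathsf V\tilde{\boldsymbol u},t),\quad t\in[0,T],\qquad \tilde{\boldsymbol u}(0)=\mathsf V^T\mathsf W\,\boldsymbol u_0,$$ for $\tilde{\boldsymbol u}(t)\in\mathbb R^{N_P}$, is well posed. Then the solution $\boldsymbol u(t)\in\mathbb R^N$ of the modal-collocation (MC) initial-value problem $$\frac{d\boldsymbol u}{dt}=-\sum_{d=1}^{D}\mathsf D_{x_d}\boldsymbol f_d(\boldsymbol u)-\mathsf W^{-1}\mathsf R_\Gamma^T\mathsf W_\Gamma\big(\boldsymbol f_n^*(\mathsf R_\Gamma\boldsymbol u,\boldsymbol g_\Gamma)-\boldsymbol f_n(\boldsymbol u)\big)+\mathsf V\mathsf V^T\mathsf W\,\boldsymbol s(\boldsymbol u,t),\quad t\in[0,T],\qquad \boldsymbol u(0)=\mathsf V\mathsf V^T\mathsf W\,\boldsymbol u_0,$$ where $\boldsymbol f_n(\boldsymbol u)=\sum_{d=1}^{D}\mathsf N_{x_d}\mathsf R_\Gamma\boldsymbol f_d(\boldsymbol u)$, is equivalent to the modal DG solution; that is, $$\boldsymbol u(t)=\mathsf V\,\tilde{\boldsymbol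 u}(t)\qquad\text{for all } t\in[0,T].$$
   Context: Setting. $\Omega\subset\mathbb R^D$ ($D\ge1$) is a (single) element domain with boundary $\Gamma$ and outward unit normal with components $n_{x_d}$. $\mathbb P^P(\Omega)$ is the space of polynomials of total degree at most $P$ on $\Omega$, of dimension $N_P=\binom{P+D}{D}$, and $\{\mathcal V_i\}_{i=1}^{N_P}$ is a basis of it that is orthonormal in $L^2(\Omega)$. Quadratures. $\{\boldsymbol x_i\}_{i=1}^N\subset\Omega$ with weights $w_i>0$ is a quadrature rule over $\Omega$ exact for polynomials of total degree $2P$; $\{\hat{\boldsymbol x}_m\}_{m=1}^M\subset\Gamma$ with weights $\hat w_m>0$ is a degree $2P$ exact quadrature rule over $\Gamma$. Put $\mathsf W=\operatorname{diag}(w_1,\dots,w_N)$, $\mathsf W_\Gamma=\operatorname{diag}(\hat w_1,\dots,\hat w_M)$, $\mathsf N_{x_d}=\operatorname{diag}(n_{x_d}(\hat{\boldsymbol x}_1),\dots,n_{x_d}(\hat{\boldsymbol x}_M))$. Matrices. $\mathsf V,\mathsf V_{x_d}\in\mathbb R^{N\times N_P}$ and $\mathsf V_\Gamma\in\mathbb R^{M\times N_P}$ are given by $[\mathsf V]_{ij}=\mathcal V_j(\boldsymbol x_i)$, $[\mathsf V_{x_d}]_{ij}=\frac{\partial\mathcal V_j}{\partial x_d}(\boldsymbol x_i)$, $[\mathsf V_\Gamma]_{mj}=\mathcal V_j(\hat{\boldsymbol x}_m)$. By orthonormality and exactness, $\mathsf V^T\mathsf W\mathsf V=\mathsf I_{N_P}$.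 The degree $P$ first-derivative modal-collocation operator is $\mathsf D_{x_d}=\mathsf V_{x_d}\mathsf V^T\mathsf W\in\mathbb R^{N\times N}$, and $\mathsf R_\Gamma=\mathsf V_\Gamma\mathsf V^T\mathsf W\in\mathbb R^{M\times N}$. Compatibility (standing assumption). The volume and boundary quadratures are degree-$P$ compatible: for each $d=1,\dots,D$, $$\mathsf V^T\mathsf W\mathsf V_{x_d}+\mathsf V_{x_d}^T\mathsf W\mathsf V=\mathsf V_\Gamma^T\mathsf W_\Gamma\mathsf N_{x_d}\mathsf V_\Gamma .$$ Data. The underlying problem is the scalar initial boundary-value problem $\partial_t\mathcal U=-\sum_d\partial_{x_d}\mathcal F_d(\mathcal U)+\mathcal S(\mathcal U,t)$ on $\Omega\times[0,T]$, with boundary condition $\sum_d\mathcal F_d(\mathcal U)n_{x_d}=\mathcal F_n^*(\mathcal U,\mathcal G)$ on $\Gamma$ for boundary data $\mathcal G(\boldsymbol x,t)$, and initial condition $\mathcal U(\boldsymbol x,0)=\mathcal U_0(\boldsymbol x)$. The functions $\mathcal F_d$, $\mathcal F_n^*$, $\mathcal S$ may be nonlinear. Their discrete counterparts act entrywise at the nodes: $\boldsymbol f_d:\mathbb R^N\to\mathbb R^N$, $[\boldsymbol f_d(\boldsymbol u)]_i=\mathcal F_d(u_i)$; $\boldsymbol f_n^*:\mathbb R^M\times\mathbb R^M\to\mathbb R^M$, $[\boldsymbol f_n^*(\boldsymbol v,\boldsymbol g_\Gamma)]_m=\mathcal F_n^*(v_m,[\boldsymbol g_\Gamma]_m)$ (evaluated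 with the normal at $\hat{\boldsymbol x}_m$), where $[\boldsymbol g_\Gamma(t)]_m=\mathcal G(\hat{\boldsymbol x}_m,t)$; $\boldsymbol s:\mathbb R^N\times\mathbb R\to\mathbb R^N$, $[\boldsymbol s(\boldsymbol u,t)]_i=\mathcal S(u_i,t)$ (evaluated at $\boldsymbol x_i$ if $\mathcal S$ also depends on $\boldsymbol x$); and $[\boldsymbol u_0]_i=\mathcal U_0(\boldsymbol x_i)$. ''Well posed'' for the DG initial-value problem is used in the sense that its solution exists on $[0,T]$ and is unique. *)

(* Defs.v *)
From HB Require Import structures.
From mathcomp Require Import all_boot all_order all_algebra.
From mathcomp Require Import all_classical all_reals all_analysis.
From mathcomp Require Import -(notations) mpoly.

Set Implicit Arguments.
Unset Strict Implicit.
Unset Printing Implicit Defensive.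

Import Order.TTheory GRing.Theory Num.Theory.
Import numFieldNormedType.Exports.

Local Open Scope classical_set_scope.
Local Open Scope ring_scope.

(* Points of R^D are row vectors; nodal and modal coefficient vectors are column
   vectors.  The library norm on matrices is the sup norm, whereas diameters,
   unit balls and unit normals refer to the Euclidean norm. *)
Definition enorm (R : realType) (D : nat) (x : 'rV[R]_D) : R :=
  Num.sqrt (\sum_i x 0 i ^+ 2).

Definition boundary (T : topologicalType) (A : set T) : set T :=
  closure A `\` interior A.

(* The outer measure X |-> inf {\sum_k g (A k) | X `<=` \bigcup_k A k} generated
   by an arbitrary set function g is the library's [mu_ext] when every set may
   occur in a cover, hence this alias carrying the discrete sigma-algebra. *)
Definition all_measurable (T : Type) : Type := T.

HB.instance Definition _ (T : pointedType) := Pointed.on (all_measurable T).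
HB.instance Definition _ (T : pointedType) :=
  @isMeasurable.Build default_measure_display (all_measurable T)
    [set: set (all_measurable T)] I (fun _ _ => I) (fun _ _ => I).

Section cover_outer.
Variables (R : realType) (T : pointedType) (g : set T -> \bar R).
Local Open Scope ereal_scope.

Definition cover_outer : set T -> \bar R :=
  mu_ext (g : set (all_measurable T) -> \bar R).

Hypotheses (g0 : g set0 = 0) (g_ge0 : forall A, 0 <= g A).

Lemma cover_outer0 : cover_outer set0 = 0.
Proof. exact: (@mu_ext0 _ (all_measurable T) R g). Qed.

Lemma cover_outer_ge0 A : 0 <= cover_outer A.
Proof. exact: (@mu_ext_ge0 _ (all_measurable T) R g). Qed.

Lemma le_cover_outer : {homo cover_outer : A B / A `<=` B >-> A <= B}.
Proof. exact: (@le_mu_ext _ (all_measurable T) R g). Qed.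

Lemma cover_outer_sigma_subadditive : sigma_subadditive cover_outer.
Proof. exact: (@mu_ext_sigma_subadditive _ (all_measurable T) R g). Qed.

End cover_outer.

Section lebesgue.
Variables (R : realType) (D : nat).
Local Open Scope ereal_scope.

(* Volume of the smallest box containing A.  The empty set is singled out for
   the sake of D = 0, where the volume of a box is the empty product 1. *)
Definition box_gauge (A : set 'rV[R]_D) : \bar R :=
  if `[< A = set0 >] then 0 else
  ereal_inf [set (\prod_i (ab.2 0 i - ab.1 0 i)%R)%R%:E |
    ab in [set ab : 'rV[R]_D * 'rV[R]_D |
      forall x, A x -> forall i, (ab.1 0 i <= x 0 i <= ab.2 0 i)%R]].

Definition lebesgue_outer : set 'rV[R]_D -> \bar R := cover_outer box_gauge.

Lemma box_gauge0 : box_gauge set0 = 0.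
Proof. by rewrite /box_gauge asboolT. Qed.

Lemma box_gauge_ge0 A : 0 <= box_gauge A.
Proof.
rewrite /box_gauge; case: asboolP => // /eqP/set0P[x Ax].
apply: le_ereal_inf_tmp => _ [[a b] /= /(_ x Ax) abx <-].
rewrite lee_fin; apply: prodr_ge0 => i _; rewrite subr_ge0.
by have /andP[/le_trans] := abx i; apply.
Qed.

HB.instance Definition _ := isOuterMeasure.Build R 'rV[R]_D lebesgue_outer
  (cover_outer0 box_gauge0 box_gauge_ge0) (cover_outer_ge0 box_gauge_ge0)
  (@le_cover_outer _ _ box_gauge) (cover_outer_sigma_subadditive box_gauge_ge0).

Definition unit_ball_volume : R := fine (lebesgue_outer [set x | enorm x <= 1]%R).

Lemma unit_ball_volume_ge0 : (0 <= unit_ball_volume)%R.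
Proof. exact/fine_ge0/outer_measure_ge0. Qed.

(* The restriction of the outer measure to its Caratheodory-measurable sets. *)
Definition lebesgue_measure_rV :
    {measure set (caratheodory_type lebesgue_outer) -> \bar R} :=
  (lebesgue_outer : {outer_measure set 'rV[R]_D -> \bar R}).

End lebesgue.

Section hausdorff.
Variables (R : realType) (s D : nat).
Local Open Scope ereal_scope.

(* alpha_s (diam A / 2)^s if A is nonempty with diam A <= delta, and +oo if
   diam A > delta, where alpha_s is the volume of the unit ball of R^s.  With
   this normalization the s-dimensional Hausdorff measure is the surface measure
   on s-dimensional C^1 surfaces, and the counting measure for s = 0. *)
Definition hausdorff_gauge (delta : R) (A : set 'rV[R]_D) : \bar R :=
  if `[< A = set0 >] then 0 else
  ereal_inf [set (unit_ball_volume R s * (r / 2) ^+ s)%R%:E |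
    r in [set r : R | (0 <= r <= delta)%R /\
      forall x y, A x -> A y -> (enorm (x - y)%R <= r)%R]].

Definition hausdorff_outer (A : set 'rV[R]_D) : \bar R :=
  ereal_sup [set cover_outer (hausdorff_gauge delta) A |
    delta in [set delta : R | (0 < delta)%R]].

Lemma hausdorff_gauge0 delta : hausdorff_gauge delta set0 = 0.
Proof. by rewrite /hausdorff_gauge asboolT. Qed.

Lemma hausdorff_gauge_ge0 delta A : 0 <= hausdorff_gauge delta A.
Proof.
rewrite /hausdorff_gauge; case: asboolP => // _.
apply: le_ereal_inf_tmp => _ [r [/andP[r0 _] _] <-].
by rewrite lee_fin mulr_ge0 ?unit_ball_volume_ge0// exprn_ge0// divr_ge0.
Qed.

Let cover_ge0 delta A : 0 <= cover_outer (hausdorff_gauge delta) A.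
Proof. exact/cover_outer_ge0/hausdorff_gauge_ge0. Qed.

Let hausdorff_outer_ge0 A : 0 <= hausdorff_outer A.
Proof.
apply: le_trans (cover_ge0 1 A) _.
by apply: ereal_sup_ubound; exists 1%R => //=; rewrite ltr01.
Qed.

Let hausdorff_outer0 : hausdorff_outer set0 = 0.
Proof.
apply/eqP; rewrite eq_le hausdorff_outer_ge0 andbT.
apply: ge_ereal_sup => _ [delta _ <-].
by rewrite cover_outer0//; [exact: hausdorff_gauge0 | exact: hausdorff_gauge_ge0].
Qed.

Let le_hausdorff_outer : {homo hausdorff_outer : A B / A `<=` B >-> A <= B}.
Proof.
move=> A B AB; apply: ge_ereal_sup => _ [delta delta0 <-].
apply: le_trans (le_cover_outer _ AB) _.
by apply: ereal_sup_ubound; exists delta.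
Qed.

Let hausdorff_outer_sigma_subadditive : sigma_subadditive hausdorff_outer.
Proof.
move=> A; apply: ge_ereal_sup => _ [delta delta0 <-].
apply: (le_trans (cover_outer_sigma_subadditive (hausdorff_gauge_ge0 delta) A)).
apply: lee_nneseries => k _; first by move=> _; exact: cover_ge0.
by apply: ereal_sup_ubound; exists delta.
Qed.

HB.instance Definition _ := isOuterMeasure.Build R 'rV[R]_D hausdorff_outer
  hausdorff_outer0 hausdorff_outer_ge0 le_hausdorff_outer
  hausdorff_outer_sigma_subadditive.

Definition hausdorff_measure :
    {measure set (caratheodory_type hausdorff_outer) -> \bar R} :=
  (hausdorff_outer : {outer_measure set 'rV[R]_D -> \bar R}).

End hausdorff.

Section integrals.
Variables (R : realType) (D : nat) (Omega : set 'rV[R]_D).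

Definition volume_integral (f : 'rV[R]_D -> R) : \bar R :=
  (\int[lebesgue_measure_rV R D]_(x in Omega) (f x)%:E)%E.

Definition surface_integral (f : 'rV[R]_D -> R) : \bar R :=
  (\int[hausdorff_measure R D.-1 D]_(x in boundary Omega) (f x)%:E)%E.

End integrals.

Section element.
Variables (R : realType) (D : nat).
Implicit Types (Omega : set 'rV[R]_D) (x nu : 'rV[R]_D).

Definition partial (d : 'I_D) (f : 'rV[R]_D -> R) x : R :=
  'D_(delta_mx 0 d) f x.

Definition grad (f : 'rV[R]_D -> R) x : 'rV[R]_D := \row_d partial d f x.

(* Near x, the set Omega is, up to points of {rho = 0}, the sublevel set
   {rho < 0} of a C^1 function with nonzero gradient, and nu is the normalized
   gradient of rho at x. *)
Definition outward_normal_at Omega x nu : Prop :=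
  exists rho : 'rV[R]_D -> R,
    [/\ (\forall y \near x,
           differentiable rho y /\ {for y, continuous (grad rho)}),
        rho x = 0,
        (\forall y \near x, (rho y < 0 -> Omega y) /\ (0 < rho y -> ~ Omega y)),
        grad rho x != 0 &
        nu = (enorm (grad rho x))^-1 *: grad rho x].

Definition regular_boundary_point Omega x : Prop :=
  exists nu, outward_normal_at Omega x nu.

(* A bounded domain, taken with an arbitrary part of its boundary (so that both
   open and closed elements are covered), whose boundary has finite surface
   measure and possesses an outward unit normal almost everywhere. *)
Definition element_domain Omega : Prop :=
  [/\ bounded_set Omega,
      interior Omega !=set0,
      connected (interior Omega),
      Omega `<=` closure (interior Omega) &
      (hausdorff_outer D.-1 (boundary Omega) < +oo)%E /\
      hausdorff_outer D.-1
        (boundary Omega `\` regular_boundary_point Omega) = 0%E].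

(* No value is prescribed at corners and edges, where the normal is undefined. *)
Definition outward_unit_normal Omega (n : 'rV[R]_D -> 'rV[R]_D) : Prop :=
  forall x nu, outward_normal_at Omega x nu -> n x = nu.

(* Polynomial functions of total degree at most k; [msize] is the total degree
   plus one (and 0 for the zero polynomial). *)
Definition poly_space (k : nat) : set ('rV[R]_D -> R) :=
  [set f | exists2 p : mpoly D R, (mpoly.msize p <= k.+1)%N &
     f = fun x => meval (fun d => x 0 d) p].

(* Two polynomials are the same element of P^k(Omega) when they agree on Omega. *)
Definition poly_basis (k : nat) Omega (n : nat)
    (b : 'I_n -> 'rV[R]_D -> R) : Prop :=
  (forall j, poly_space k (b j)) /\
  forall f, poly_space k f ->
    exists! c : 'rV[R]_n, forall x, Omega x -> f x = \sum_j c 0 j * b j x.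

Definition orthonormal_on Omega (n : nat) (b : 'I_n -> 'rV[R]_D -> R) : Prop :=
  forall i j,
    volume_integral Omega (fun x => b i x * b j x) = ((i == j)%:R : R)%:E.

Definition quadrature (J : ('rV[R]_D -> R) -> \bar R) (A : set 'rV[R]_D)
    (k n : nat) (x : 'I_n -> 'rV[R]_D) (w : 'rV[R]_n) : Prop :=
  [/\ (forall i, A (x i)),
      (forall i, 0 < w 0 i) &
      (forall f, poly_space k f -> J f = (\sum_i w 0 i * f (x i))%:E)].

End element.

Section ivp.
Variables (R : realType) (n : nat).
Implicit Types (T : R) (rhs : R -> 'cV[R]_n -> 'cV[R]_n) (u : R -> 'cV[R]_n).

(* The derivative is one-sided at t = 0 and t = T. *)
Definition ivp_solution T rhs (u0 : 'cV[R]_n) u : Prop :=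
  u 0 = u0 /\
  forall t, 0 <= t <= T ->
    (s - t)^-1 *: (u s - u t) @[s --> within [set s | 0 <= s <= T] t^']
      --> rhs t (u t).

Definition ivp_well_posed T rhs (u0 : 'cV[R]_n) : Prop :=
  (exists u, ivp_solution T rhs u0 u) /\
  forall u v, ivp_solution T rhs u0 u -> ivp_solution T rhs u0 v ->
    forall t, 0 <= t <= T -> u t = v t.

End ivp.

(* Main.v *)
Require Import Defs.
From HB Require Import structures.
From mathcomp Require Import all_boot all_order all_algebra.
From mathcomp Require Import all_classical all_reals all_analysis.
From mathcomp Require Import ring lra.
From mathcomp Require Import -(notations) mpoly.

Set Implicit Arguments.
Unset Strict Implicit.
Unset Printing Implicit Defensive.

Import Order.TTheory GRing.Theory Num.Theory.
Import numFieldNormedType.Exports.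

Local Open Scope classical_set_scope.
Local Open Scope ring_scope.

(** Write [Q = V^T W], so that [Q V = 1] by orthonormality of the modes and
    exactness of the volume quadrature on products of two of them.  The matrix
    [V Q] is the [W]-orthogonal projection of nodal vectors onto the samples of
    polynomials of degree at most [P].

    The columns of [Vx d] are samples of derivatives of such polynomials, which
    are polynomials of the same degree; hence [V Q Vx d = Vx d].  Combined with
    the compatibility of the quadratures, this gives the identity
    [V VG^T WG Nx VG Q = Vx Q + V Vx^T W] ([lift_summation_by_parts]): lifting
    the interior normal flux off the boundary undoes the strong-form volume term
    [Vx Q] and leaves the weak-form one [Vx^T W], seen at the nodes.  Along
    [u = V v], the collocation right-hand side is therefore [V] times the modal
    one.  At an arbitrary nodal vector [u] it still takes its values in the
    image of [V]: its terms start with [Vx d], with [V], or with the lifting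
    operator [W^-1 RG^T], which equals [V VG^T].

    What remains is a statement on initial-value problems ([ivp_factor]).
    A solution [u] of the collocation problem starts in the image of [V] and has
    its velocity there, so [(1 - V Q) u] has derivative zero, is constantly equal
    to its initial value zero, and [u = V (Q u)].  Then [Q u] solves the modal
    problem, so uniqueness for the latter identifies it; conversely [V] maps
    modal solutions to collocation solutions, which gives existence. *)

(** * Derivatives and products of polynomial functions *)

Section polynomial_functions.
Variables (R : realType) (D : nat).
Implicit Types (f g : 'rV[R]_D -> R) (p : mpoly D R).

Local Notation mfun p := (fun y : 'rV[R]_D => meval (fun e => y 0 e) p).

Lemma is_derive_coord (v x : 'rV[R]_D) (e : 'I_D) :
  is_derive x v (fun y : 'rV[R]_D => y 0 e) (v 0 e).
Proof.
apply: DeriveDef; first exact/diff_derivable/differentiable_coord.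
apply: lim_near_cst => //; near=> h; apply/eqP.
rewrite /= !mxE addrK /GRing.scale /= mulrA mulVf ?mul1r//.
near: h; exact: nbhs_dnbhs_neq.
Unshelve. all: by end_near. Qed.

(** The analytic partial derivative of a polynomial function is its formal one:
    the identity holds for constants and coordinates and passes to products and
    sums, hence to all monomials and then to all polynomials. *)
Lemma is_derive_meval p (d : 'I_D) (x : 'rV[R]_D) :
  is_derive x (delta_mx 0 d) (mfun p) (mfun (mderiv d p) x).
Proof.
pose dp p := is_derive x (delta_mx 0 d) (mfun p) (mfun (mderiv d p) x).
have dpC c : dp (mpolyC D c).
  rewrite /dp mderivC mevalC; under eq_fun do rewrite mevalC; exact: is_derive_cst.
have dpX e : dp (mpolyX R (mnm1 e)).
  rewrite /dp; under eq_fun do rewrite mevalXU.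
  apply: is_derive_eq; first exact: is_derive_coord.
  rewrite mderivX mevalZ mnm1E mxE eqxx /=.
  have [->|] := eqVneq e d; last by rewrite mul0r.
  suff -> : mnm_sub (mnm1 d) (mnm1 d) = @mnm0 D by rewrite mpolyX0 meval1 mulr1.
  by apply/mnmP => k; rewrite mnmBE subnn mnm0E.
have dpM q r : dp q -> dp r -> dp (q * r).
  move=> dq dr; rewrite /dp; under eq_fun do rewrite mevalM.
  apply: (is_derive_eq (is_deriveM dq dr)).
  rewrite mderivM mevalD !mevalM /GRing.scale /= addrC; congr (_ + _).
  by rewrite mulrC.
rewrite -[is_derive _ _ _ _]/(dp p).
elim/mpolyind: p => [|c m p _ _ IH].
  by rewrite -(mpolyC0 D R).
rewrite /dp; under eq_fun do rewrite mevalD.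
rewrite mderivD mevalD; apply: is_deriveD => //.
rewrite -mul_mpolyC; apply: (dpM) => //.
rewrite mpolyXE_id; elim/big_ind: _ => //; first by rewrite -mpolyC1.
move=> e _; elim: (m e) => [|k IHk]; first by rewrite expr0 -mpolyC1.
by rewrite exprS; apply: dpM.
Qed.

Lemma msize_mderiv_le d p :
  (mmeasure mdeg (mderiv d p) <= mmeasure mdeg p)%N.
Proof.
rewrite {1}msizeE; apply/bigmax_leqP_seq => m; rewrite mcoeff_msupp mcoeff_mderiv.
move=> pm _; apply: (@leq_trans (mdeg (mnm_add m (mnm1 d))).+1).
  by rewrite mdegD mdeg1 addn1.
apply: mmeasure_mnm_lt; rewrite mcoeff_msupp.
by apply: contraNneq pm => ->; rewrite mul0rn.
Qed.

Lemma poly_space_partial k d f : poly_space k f -> poly_space k (partial d f).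
Proof.
move=> [p pk ->]; exists (mderiv d p).
  exact: leq_trans (msize_mderiv_le d p) pk.
by apply/funext => x; exact: (@derive_val _ _ _ _ _ _ _ (is_derive_meval p d x)).
Qed.

Lemma poly_spaceM k l f g :
  poly_space k f -> poly_space l g -> poly_space (k + l) (f \* g).
Proof.
move=> [p pk ->] [q ql ->]; exists (p * q); last first.
  by apply/funext => x; rewrite mevalM.
have [->|p0] := eqVneq p 0; first by rewrite mul0r mmeasure0.
have [->|q0] := eqVneq q 0; first by rewrite mulr0 mmeasure0.
by rewrite msizeM// -subn1 leq_subLR add1n -addSn -addnS leq_add.
Qed.

End polynomial_functions.

(** * Initial-value problems and linear maps *)

Section ivp_lemmas.
Variable R : realType.

(** The neighbourhoods of a matrix are generated entrywise, so continuity reduces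
    to that of the entries, which are finite sums of scaled coordinates. *)
Lemma mulmx_continuous m n (A : 'M[R]_(m, n)) :
  continuous (fun u : 'cV[R]_n => A *m u).
Proof.
have Aij i j : continuous (fun u : 'cV[R]_n => (A *m u) i j).
  under eq_fun do rewrite mxE.
  apply: continuous_big => [|k _ u]; first exact: add_continuous.
  by apply: continuousM; [exact: cst_continuous | exact: coord_continuous].
move=> u P [Q uQ QP]; suff: \forall v \near u, forall i j, Q i j ((A *m v) i j).
  by apply: filterS => v Qv; exact: QP.
apply: (@filter_forall _ _ (fun i v => forall j, Q i j ((A *m v) i j)) (nbhs u))
  => i.
apply: (@filter_forall _ _ (fun j v => Q i j ((A *m v) i j)) (nbhs u))
  => j.
exact/Aij/uQ.
Qed.

(** The mean value theorem.  The difference quotients are restricted to [[0, T]],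
    so at the end points the hypothesis only concerns a one-sided derivative;
    this still gives the continuity up to the boundary. *)
Lemma within_derive0_cst (T : R) (f : R -> R) :
  (forall t, 0 <= t <= T ->
    (s - t)^-1 * (f s - f t) @[s --> within [set s | 0 <= s <= T] t^']
      --> (0 : R)) ->
  forall t, 0 <= t <= T -> f t = f 0.
Proof.
move=> f0.
(* This linear bound serves both the continuity, with e = 1, and the vanishing of
   the two-sided derivative in the interior. *)
have f0e t e : 0 <= t <= T -> 0 < e -> exists2 d, 0 < d & forall s, 0 <= s <= T ->
    `|s - t| < d -> `|f s - f t| <= e * `|s - t|.
  move=> tT e0; have /cvgrPdist_lt/(_ e e0) := f0 t tT.
  move=> /nbhs_ballP[d /= d0 dP]; exists d => // s sT std.
  have [->|st] := eqVneq s t; first by rewrite !subrr normr0 mulr0.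
  have := dP s; rewrite /ball /= distrC std => /(_ isT st sT).
  have st0 : 0 < `|s - t| by rewrite normr_gt0 subr_eq0.
  rewrite sub0r normrN normrM normfV mulrC ltr_pdivrMr// => /ltW; exact.
move=> t /andP[t0 tT].
have [u| |c _] := @MVT_segment _ f (fun=> 0) 0 t t0; last first.
- by rewrite mul0r => /eqP; rewrite subr_eq0 => /eqP.
- apply/subspace_continuousP => u /=; rewrite in_itv /= => /andP[u0 ut].
  have uT : 0 <= u <= T by rewrite u0 (le_trans ut).
  have [d d0 dP] := f0e u 1 uT ltr01.
  apply/cvgrPdist_lt => e e0; rewrite near_withinE.
  near=> s => /=; rewrite in_itv /= => /andP[s0 st].
  have sd : `|s - u| < Num.min d e.
    rewrite distrC; near: s; apply: nbhsx_ballx.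
    by rewrite lt_min d0.
  move: sd; rewrite lt_min => /andP[sd se].
  rewrite distrC; apply: le_lt_trans (dP s _ sd) _; last by rewrite mul1r.
  by rewrite s0 (le_trans st).
- rewrite in_itv /= => /andP[u0 ut].
  have uT : 0 <= u <= T by rewrite (ltW u0) (le_trans (ltW ut)).
  suff : (fun h => h^-1 *: ((f \o shift u) (h *: 1) - f u)) @ 0^' --> (0 : R).
    by move=> fu; apply: DeriveDef; [apply/cvg_ex; exists 0|exact: cvg_lim fu].
  apply/cvgrPdist_le => e e0; have [d d0 dP] := f0e u e uT e0.
  near=> h.
  have h0 : h != 0 by near: h; exact: nbhs_dnbhs_neq.
  (* The bounds by u and T - u keep h + u inside [0, T]. *)
  have : `|h| < Num.min d (Num.min u (T - u)).
    near: h; apply: dnbhs0_lt.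
    by rewrite !lt_min d0 u0 subr_gt0 (lt_le_trans ut).
  rewrite !lt_min => /and3P[hd hu hT].
  rewrite sub0r normrN normrZ normfV ler_pdivrMl ?normr_gt0// mulrC /=.
  have := dP (h *: 1 + u); rewrite addrK /GRing.scale /= mulr1; apply => //.
  have : `|h| < u /\ `|h| < T - u by []. 
  by move=> []; rewrite !ltr_norml => /andP[? ?] /andP[? ?]; lra.
Unshelve. all: by end_near. Qed.

Lemma ivp_solution_mulmx T m n (A : 'M[R]_(m, n)) rhs rhs' v0 v :
  (forall t, 0 <= t <= T -> A *m rhs t (v t) = rhs' t (A *m v t)) ->
  ivp_solution T rhs v0 v ->
  ivp_solution T rhs' (A *m v0) (fun t => A *m v t).
Proof.
move=> Arhs [v0E dv]; split=> [|t tT]; first by rewrite v0E.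
rewrite -Arhs//.
under eq_fun do rewrite -mulmxBr scalemxAr.
exact: continuous_cvg (@mulmx_continuous _ _ A _) (dv t tT).
Qed.

Lemma ivp_solution_cst T n rhs (v0 : 'cV[R]_n) v :
  (forall t, 0 <= t <= T -> rhs t (v t) = 0) -> ivp_solution T rhs v0 v ->
  forall t, 0 <= t <= T -> v t = v0.
Proof.
move=> rhs0 [v0E dv] t tT; apply/matrixP => i j; rewrite -v0E.
apply: (@within_derive0_cst T (fun s => v s i j)) => // s sT.
have := dv s sT; rewrite rhs0// => vs.
have -> : (fun r => (r - s)^-1 * (v r i j - v s i j)) =
    (fun M : 'cV[R]_n => M i j) \o (fun r => (r - s)^-1 *: (v r - v s)).
  by apply/funext => r; rewrite /= !mxE.
have := continuous_cvg _ (@coord_continuous _ _ _ i j 0) vs; rewrite mxE; exact.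
Qed.

(** If [V] is injective, intertwines [g] with [h], and contains the values of [h]
    in its image, then the problem for [h] started in that image lives entirely
    in it and is a copy of the problem for [g].  That [h] takes its values in the
    image everywhere, and not only over that image, is what prevents solutions
    from leaving it. *)
Lemma ivp_factor T m n (V : 'M[R]_(m, n)) (Q : 'M[R]_(n, m)) g h v0 :
  Q *m V = 1%:M ->
  (forall t v, h t (V *m v) = V *m g t v) ->
  (forall t u, exists y, h t u = V *m y) ->
  ivp_well_posed T g v0 ->
  ivp_well_posed T h (V *m v0) /\
  forall v u, ivp_solution T g v0 v -> ivp_solution T h (V *m v0) u ->
    forall t, 0 <= t <= T -> u t = V *m v t.
Proof.
move=> QV hV imh [[v vP] uniq].
have VQu u : ivp_solution T h (V *m v0) u ->
    forall t, 0 <= t <= T -> V *m (Q *m u t) = u t.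
  move=> uP t tT; pose A : 'M[R]_m := 1%:M - V *m Q.
  have AV : A *m V = 0 by rewrite mulmxBl mul1mx -mulmxA QV mulmx1 subrr.
  have /ivp_solution_cst/(_ _ tT) : ivp_solution T (fun _ _ => 0)
      (A *m (V *m v0)) (fun t => A *m u t).
    apply: ivp_solution_mulmx uP => s sT.
    by have [y ->] := imh s (u s); rewrite mulmxA AV mul0mx.
  rewrite mulmxA AV mul0mx mulmxBl mul1mx -mulmxA => /(_ (fun _ _ => erefl)).
  by move=> /eqP; rewrite subr_eq0 => /eqP <-.
have uV v' u : ivp_solution T g v0 v' -> ivp_solution T h (V *m v0) u ->
    forall t, 0 <= t <= T -> u t = V *m v' t.
  move=> v'P uP t tT; rewrite -(VQu u uP t tT); congr (_ *m _).
  apply: (uniq (fun s => Q *m u s) v' _ v'P t tT).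
  rewrite -[v0]mul1mx -QV -mulmxA; apply: ivp_solution_mulmx (uP) => s sT.
  by rewrite -{1}(VQu u uP s sT) hV mulmxA QV mul1mx.
split=> //; split=> [|u1 u2 u1P u2P t tT]; last by rewrite (uV v u1)// (uV v u2).
by exists (fun t => V *m v t); apply: ivp_solution_mulmx vP => t _; rewrite hV.
Qed.

End ivp_lemmas.

(** * The discrete operators *)

Section discrete.
Variables (R : realType) (D P N : nat) (Omega : set 'rV[R]_D).
Variables (J : nat) (phi : 'I_J -> 'rV[R]_D -> R).
Variables (x : 'I_N -> 'rV[R]_D) (w : 'rV[R]_N).

Let V : 'M[R]_(N, J) := \matrix_(i, j) phi j (x i).

(** The product of two modes has degree at most [2 * P], so the quadrature
    computes its integral exactly. *)
Lemma quadrature_gram1 : (forall j, poly_space P (phi j)) ->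
  orthonormal_on Omega phi -> quadrature (volume_integral Omega) Omega (2 * P) x w ->
  V^T *m diag_mx w *m V = 1%:M.
Proof.
move=> phiP phi1 [_ _ xw]; apply/matrixP => i j.
have := phi1 i j; rewrite xw; last by rewrite mul2n -addnn; exact: poly_spaceM.
move=> [E]; rewrite [RHS]mxE -E mxE; apply: eq_bigr => k _.
by rewrite mul_mx_diag !mxE; ring.
Qed.

Lemma poly_basis_samples f : poly_basis P Omega phi -> (forall i, Omega (x i)) ->
  poly_space P f -> exists c : 'cV[R]_J, \col_i f (x i) = V *m c.
Proof.
move=> [_ basis] xO /basis[c [cE _]]; exists c^T; apply/colP => i.
by rewrite !mxE cE//; apply: eq_bigr => j _; rewrite !mxE mulrC.
Qed.

End discrete.

Section sbp.
Variables (F : fieldType) (N M J : nat).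
Variables (w : 'rV[F]_N) (V Vx : 'M[F]_(N, J)) (VG : 'M[F]_(M, J)) (B : 'M[F]_M).
Let W := diag_mx w.
Let Q := V^T *m W.

(** Multiplying the summation-by-parts identity by [V] and [Q] turns its two volume
    terms into [V Q Vx Q] and [V (Vx^T W V) Q].  The first is [Vx Q] since [V Q]
    fixes [Vx], the second is [V Vx^T W] since [V Q] is self-adjoint for the
    inner product of [W]. *)
Lemma lift_summation_by_parts : Q *m V = 1%:M -> V *m Q *m Vx = Vx ->
  Q *m Vx + Vx^T *m W *m V = VG^T *m B *m VG ->
  V *m VG^T *m B *m VG *m Q = Vx *m Q + V *m Vx^T *m W.
Proof.
move=> QV VQVx sbp.
have WT : W^T = W by rewrite tr_diag_mx.
have VxQ : Vx^T *m W *m V *m Q = Vx^T *m W.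
  transitivity (W *m (V *m Q *m Vx))^T; last by rewrite VQVx trmx_mul WT.
  by rewrite !trmx_mul trmxK WT /Q !mulmxA.
have -> : V *m VG^T *m B *m VG *m Q = V *m (VG^T *m B *m VG) *m Q by rewrite !mulmxA.
rewrite -sbp mulmxDr mulmxDl mulmxA VQVx; congr (_ + _).
by rewrite -[in LHS]mulmxA VxQ mulmxA.
Qed.

End sbp.

Theorem theorem3 (R : realType) (D P N M : nat) (hD : (0 < D)%N)
  (Omega : set 'rV[R]_D) (n : 'rV[R]_D -> 'rV[R]_D)
  (hOmega : element_domain Omega) (hn : outward_unit_normal Omega n)
  (phi : 'I_('C(P + D, D)) -> 'rV[R]_D -> R)
  (hphi : poly_basis P Omega phi) (hphi1 : orthonormal_on Omega phi)
  (x : 'I_N -> 'rV[R]_D) (w : 'rV[R]_N) (xh : 'I_M -> 'rV[R]_D) (wh : 'rV[R]_M)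
  (hx : quadrature (volume_integral Omega) Omega (2 * P) x w)
  (hxh : quadrature (surface_integral Omega) (boundary Omega) (2 * P) xh wh)
  (T : R) (hT : 0 < T)
  (F : 'I_D -> R -> R) (Fstar : 'rV[R]_D -> R -> R -> R)
  (S : 'rV[R]_D -> R -> R -> R) (G : 'rV[R]_D -> R -> R) (U0 : 'rV[R]_D -> R) :
  let NP := 'C(P + D, D) in
  let W := diag_mx w in
  let WG := diag_mx wh in
  let Nx d := diag_mx (\row_m n (xh m) 0 d) in
  let V : 'M[R]_(N, NP) := \matrix_(i, j) phi j (x i) in
  let Vx d : 'M[R]_(N, NP) := \matrix_(i, j) partial d (phi j) (x i) in
  let VG : 'M[R]_(M, NP) := \matrix_(m, j) phi j (xh m) in
  let Dx d := Vx d *m V^T *m W in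
  let RG := VG *m V^T *m W in
  let f d (u : 'cV[R]_N) : 'cV[R]_N := \col_i F d (u i 0) in
  let fnstar (v g : 'cV[R]_M) : 'cV[R]_M :=
    \col_m Fstar (n (xh m)) (v m 0) (g m 0) in
  let s (u : 'cV[R]_N) (t : R) : 'cV[R]_N := \col_i S (x i) (u i 0) t in
  let gG (t : R) : 'cV[R]_M := \col_m G (xh m) t in
  let u0 : 'cV[R]_N := \col_i U0 (x i) in
  let fn (u : 'cV[R]_N) := \sum_(d < D) Nx d *m RG *m f d u in
  let rhsDG (t : R) (ut : 'cV[R]_NP) : 'cV[R]_NP :=
    \sum_(d < D) (Vx d)^T *m W *m f d (V *m ut)
    - VG^T *m WG *m fnstar (VG *m ut) (gG t)
    + V^T *m W *m s (V *m ut) t in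
  let rhsMC (t : R) (u : 'cV[R]_N) : 'cV[R]_N :=
    - (\sum_(d < D) Dx d *m f d u)
    - invmx W *m RG^T *m WG *m (fnstar (RG *m u) (gG t) - fn u)
    + V *m V^T *m W *m s u t in
  (forall d, V^T *m W *m Vx d + (Vx d)^T *m W *m V = VG^T *m WG *m Nx d *m VG) ->
  ivp_well_posed T rhsDG (V^T *m W *m u0) ->
  ivp_well_posed T rhsMC (V *m V^T *m W *m u0) /\
  forall (ut : R -> 'cV[R]_NP) (u : R -> 'cV[R]_N),
    ivp_solution T rhsDG (V^T *m W *m u0) ut ->
    ivp_solution T rhsMC (V *m V^T *m W *m u0) u ->
    forall t, 0 <= t <= T -> u t = V *m ut t.
Proof.
move=> NP W WG Nx V Vx VG Dx RG f fnstar s gG u0 fn rhsDG rhsMC sbp DG_wp.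
have [phiP _] := hphi; have [xO w0 _] := hx.
pose Q := V^T *m W.
have QV : Q *m V = 1%:M by exact: quadrature_gram1 hx.
(* The derivative of a mode is again a combination of modes. *)
have VQVx d : V *m Q *m Vx d = Vx d.
  apply/matrixP => i j; suff /colP/(_ i) : col j (V *m Q *m Vx d) = col j (Vx d).
    by rewrite !mxE.
  rewrite colE -mulmxA -colE.
  have /(poly_basis_samples hphi xO)[c cE] := poly_space_partial d (phiP j).
  have -> : col j (Vx d) = V *m c by rewrite -cE; apply/colP => k; rewrite !mxE.
  by rewrite mulmxA -(mulmxA V) QV mulmx1.
have WVr : invmx W *m RG^T = V *m VG^T.
  have Wu : W \in unitmx.
    by rewrite unitmxE det_diag unitfE; apply/prodf_neq0 => i _; rewrite gt_eqF.
  by rewrite !trmx_mul trmxK tr_diag_mx mulKmx.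
have u0E : V *m V^T *m W *m u0 = V *m (V^T *m W *m u0) by rewrite !mulmxA.
rewrite u0E; apply: (ivp_factor QV) => // [t v|t u].
  rewrite /rhsMC /rhsDG WVr.
  have RGV : RG *m V = VG by rewrite /RG -!mulmxA (mulmxA V^T) QV mulmx1.
  rewrite (mulmxA RG) RGV; set a := fnstar _ _.
  pose ff d := f d (V *m v).
  have fnE : V *m VG^T *m WG *m fn (V *m v) =
      \sum_(d < D) Dx d *m ff d + V *m (\sum_(d < D) (Vx d)^T *m W *m ff d).
    rewrite !mulmx_sumr -big_split; apply: eq_bigr => d _ /=.
    have := lift_summation_by_parts QV (VQVx d).
    move=> /(_ _ VG (WG *m Nx d)); rewrite !mulmxA => /(_ (sbp d)) E.
    by rewrite E mulmxDl.
  rewrite (mulmxBr _ a) fnE !mulmxDr mulmxN !mulmxA opprB.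
  by rewrite -!addrA addKr.
exists (- (Q *m \sum_(d < D) Dx d *m f d u) -
  VG^T *m WG *m (fnstar (RG *m u) (gG t) - fn u) + V^T *m W *m s u t).
have VQD : V *m (Q *m \sum_(d < D) Dx d *m f d u) = \sum_(d < D) Dx d *m f d u.
  rewrite mulmxA mulmx_sumr; apply: eq_bigr => d _.
  by rewrite /Dx -!(mulmxA (Vx d)) (mulmxA (V *m Q)) VQVx.
by rewrite /rhsMC WVr !(mulmxDr V) !(mulmxN V) VQD !mulmxA.
Qed.
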